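(* Let $\mu$ be a nonzero finite Borel measure on $\mathbb{R}^d$. For any subset $\Xi$ of $\Theta$, $$\mathcal{E}_{\operatorname{cl}(\Xi)\cap\Theta}\supseteq\operatorname{cl}_v(\mathcal{E}_\Xi)\cap\mathcal{E}\supseteq\operatorname{cl}_I(\mathcal{E}_\Xi).$$ When $\Xi$ is convex, both inclusions are equalities.
   Context: The convex support $\operatorname{cs}(\mu)$ is the intersection of all closed convex subsets $C$ of $\mathbb{R}^d$ with $\mu(C)=\mu(\mathbb{R}^d)$; $\operatorname{lin}(\mu)$ is the linear subspace obtained by shifting the affine hull of $\operatorname{cs}(\mu)$ to contain the origin. $\Lambda(\vartheta)=\ln\int_{\mathbb{R}^d}e^{\langle\vartheta,x\rangle}\mu(dx)$, $\operatorname{dom}(\Lambda)=\{\Lambda<\infty\}$, $\Theta=\operatorname{dom}(\Lambda)\cap\operatorname{lin}(\mu)$; for $\vartheta\in\operatorname{dom}(\Lambda)$, $Q_\vartheta$ is the probability measure with $\mu$-density $e^{\langle\vartheta,x\rangle-\Lambda(\vartheta)}$. For $\Xi\subseteq\Theta$, $\mathcal{E}_\Xi=\{Q_\vartheta:\vartheta\in\Xi\}$, and $\mathcal{E}=\mathcal{E}_\Theta$. $\operatorname{cl}$ denotes closure in $\mathbb{R}^d$. The $I$-divergence is $D(P\|Q)=\int\ln\frac{dP}{dQ}\,dP$ if $P\ll Q$ and $+\infty$ otherwise. For a set $\mathcal{S}$ of Borel probability measures on $\mathbb{R}^d$, the variation closure $\operatorname{cl}_v(\mathcal{S})$, resp.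 the $I$-closure $\operatorname{cl}_I(\mathcal{S})$, is the set of all probability measures $P$ for which there is a sequence $Q_n$ in $\mathcal{S}$ with total variation $|P-Q_n|\to0$, resp. with $D(Q_n\|P)\to0$. *)

(* Defs.v *)
From HB Require Import structures.
From mathcomp Require Import all_boot all_order all_algebra.
From mathcomp Require Import all_classical all_reals all_analysis.

Set Implicit Arguments.
Unset Strict Implicit.
Unset Printing Implicit Defensive.

Import Order.TTheory GRing.Theory Num.Theory.
Import numFieldNormedType.Exports.

Local Open Scope classical_set_scope.
Local Open Scope ring_scope.
Local Open Scope charge_scope.
Local Open Scope ereal_scope.

(* R^d with its Borel sigma-algebra. This is a notation for an alias of
   'rV[R]_d: topological and linear notions are stated on 'rV[R]_d, measures
   and integrals on the alias, and the two are convertible. *)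
Notation borelRd R d := (g_sigma_algebraType (@open 'rV[R]_d)).

Section affine.
Context {R : realType} {d : nat}.

Definition affine_set (A : set 'rV[R]_d) :=
  forall (x y : 'rV[R]_d) (t : R), A x -> A y ->
    A ((1 - t)%R *: x + t *: y)%R.

Definition affine_hull (S : set 'rV[R]_d) : set 'rV[R]_d :=
  smallest affine_set S.

Definition dotp (u v : 'rV[R]_d) : R := (\sum_(i < d) u ord0 i * v ord0 i)%R.

End affine.

Section exponential_family.
Context {R : realType} {d : nat}.
Variable mu : {finite_measure set (borelRd R d) -> \bar R}.

Definition convex_support : set 'rV[R]_d :=
  \bigcap_(C in [set C : set 'rV[R]_d |
    [/\ closed C, convex_set C & mu C = mu [set: borelRd R d]]]) C.

(* Subtracting from an affine space any one of its points gives the same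
   subspace, namely the set of all differences. *)
Definition lin : set 'rV[R]_d :=
  [set (x - y)%R | x in affine_hull convex_support
                 & y in affine_hull convex_support].

Definition Lambda (theta : 'rV[R]_d) : \bar R :=
  lne (\int[mu]_x (expR (dotp theta x))%:E).

Definition dom_Lambda : set 'rV[R]_d := [set theta | Lambda theta < +oo].

Definition Theta : set 'rV[R]_d := dom_Lambda `&` lin.

Definition Qtheta (theta : 'rV[R]_d) (A : set (borelRd R d)) : \bar R :=
  \int[mu]_(x in A) (expR (dotp theta x - fine (Lambda theta)))%:E.

(* A term of type [probability] is a function on all sets, measurable or not;
   probability measures are therefore compared on measurable sets only. *)
Definition expfam (Xi : set 'rV[R]_d) : set (probability (borelRd R d) R) :=
  [set P | exists2 theta, Xi theta &
     forall A, measurable A -> P A = Qtheta theta A].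

End exponential_family.

Section divergences.
Context {disp : measure_display} {T : measurableType disp} {R : realType}.
Implicit Types P Q : probability T R.

Definition prob_diff P Q : {charge set T -> \bar R} :=
  cadd (charge_of_finite_measure P) (copp (charge_of_finite_measure Q)).

(* The mass of the variation of P - Q, i.e. the L1 convention (between 0
   and 2); it does not depend on the Hahn decomposition that is picked. *)
Definition tv_dist P Q : \bar R :=
  let pos := cid (Hahn_decomposition (prob_diff P Q)) in
  let neg := cid (svalP pos) in
  charge_variation (svalP neg) [set: T].

Definition Idiv P Q : \bar R :=
  if `[< P `<< Q >] then \int[P]_x lne (('d (charge_of_finite_measure P) '/d Q) x)
  else +oo.

Definition variation_closure (S : set (probability T R)) :
    set (probability T R) :=
  [set P | exists2 Q : nat -> probability T R, (forall n, S (Q n)) &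
     (fun n => tv_dist P (Q n)) @ \oo --> 0].

Definition I_closure (S : set (probability T R)) : set (probability T R) :=
  [set P | exists2 Q : nat -> probability T R, (forall n, S (Q n)) &
     (fun n => Idiv (Q n) P) @ \oo --> 0].

End divergences.

(* Main.v *)
Require Import Defs.
From HB Require Import structures.
From mathcomp Require Import all_boot all_order all_algebra.
From mathcomp Require Import all_classical all_reals all_analysis.
From mathcomp Require Import measurable_realfun.
From mathcomp Require Import ring lra.

Import Order.TTheory GRing.Theory Num.Theory.
Import numFieldNormedType.Exports.

(* If Q_(theta_n) -> P in variation with mu << P, then along some indices the
   log-densities <theta_n, x> - Lambda(theta_n) converge mu-almost everywhere to
   a finite limit. The set of convergence is an affine subspace of full measure,
   so it contains the affine hull of the convex support; as theta_n lies in
   lin(mu), it follows that theta_n converges to some theta with P = Q_theta.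
   This applies to P in the family, and to P in the I-closure, because
   D(Q_n || P) -> 0 forces Q_n << P and, by a weak form of Pinsker's inequality,
   convergence in variation.

   If Xi is convex and theta is in its closure, a segment joins theta to a
   relative interior point of Xi inside Xi. With Lambda_t the value of Lambda at
   parameter t of this segment, the divergence from Q_theta is at most
   exp(Lambda_2t - 2 Lambda_t + Lambda_0) - 1, which tends to 0 with t by
   dominated convergence. *)

Local Open Scope classical_set_scope.
Local Open Scope ring_scope.

(** * Affine subspaces *)

(** An independent family of maximal size drawn from [S] spans [S], since a vector outside its row
    space could be appended to it. The size is bounded by [d]. *)
Lemma exists_row_basis (F : fieldType) (d : nat) (S : set 'rV[F]_d) :
  exists r (M : 'M[F]_(r, d)), [/\ row_free M, (forall i, S (row i M)) &
    forall v, S v -> (v <= M)%MS].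
Proof.
pose P r := `[< exists M : 'M[F]_(r, d), row_free M /\ forall i, S (row i M) >].
have P0 : exists r, P r.
  exists 0; apply/asboolP; exists 0; split; last by case.
  by rewrite /row_free mxrank0.
have Pd r : P r -> (r <= d)%N.
  move=> /asboolP[M [/eqP Mr _]].
  by rewrite -Mr; exact: rank_leq_col.
have [r /asboolP[M [Mfree MS]] rmax] := ex_maxnP P0 Pd.
exists r, M; split => // v Sv; apply/negPn/negP => vM.
suff /rmax : P (r + 1)%N by rewrite addn1 ltnn.
apply/asboolP; exists (col_mx M v); split; last first.
  move=> i; case: (split_ordP i) => j ->.
    by rewrite rowKu.
  by rewrite rowKd ord1 row_id.
have /rank_ltmx : (M < M + v)%MS.
  by rewrite ltmxE addsmxSl addsmx_sub submx_refl.
rewrite addsmxE (eqP Mfree) -addn1 => rk.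
by rewrite /row_free eqn_leq rank_leq_row rk.
Qed.

(** If [v] is killed by the Gram matrix, then [v *m M] has square norm zero, and freeness of [M]
    gives [v = 0]. *)
Lemma gram_unit (R : realFieldType) (r d : nat) (M : 'M[R]_(r, d)) :
  row_free M -> M *m M^T \in unitmx.
Proof.
move=> Mfree; rewrite -row_free_unit; apply/inj_row_free => v vMM.
apply: (row_free_inj Mfree); rewrite mul0mx.
have : (v *m M) *m (v *m M)^T = 0.
  by rewrite trmx_mul mulmxA -(mulmxA v) vMM mul0mx.
move=> /matrixP /(_ ord0 ord0); rewrite mxE [RHS]mxE => /eqP.
under eq_bigr do rewrite [X in _ * X]mxE -expr2.
rewrite psumr_eq0 => [/allP h|i _]; last exact: sqr_ge0.
apply/rowP => i; have := h i (mem_index_enum _).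
by rewrite sqrf_eq0 [RHS]mxE => /eqP.
Qed.

Section topology.
Context {R : realType}.

Lemma mx_cvg (I : Type) (F : set_system I) {FF : Filter F} (m n : nat)
    (f : I -> 'M[R]_(m, n)) (l : 'M[R]_(m, n)) :
  (forall i j, f x i j @[x --> F] --> l i j) -> f x @[x --> F] --> l.
Proof.
move=> fl; apply/cvg_ballP => e e0.
have : \forall x \near F, forall i j, ball (l i j) e (f x i j).
  apply: filter_forall => i; apply: filter_forall => j.
  exact: (cvg_ball (fl i j)).
by apply: filterS => x h; split.
Qed.

Lemma mulmxr_continuous (d k : nat) (A : 'M[R]_(d, k)) :
  continuous (fun v : 'rV[R]_d => v *m A).
Proof.
move=> v; apply: (mx_cvg _ (nbhs v)) => i j; rewrite mxE.
under eq_fun do rewrite mxE.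
apply: cvg_big => [|l _]; first exact: add_continuous.
apply: cvgMr_tmp; exact: coord_continuous.
Qed.

(** The row space is the zero set of the continuous map [v |-> v *m cokermx M]. *)
Lemma submx_closed (k d : nat) (M : 'M[R]_(k, d)) :
  closed [set v : 'rV[R]_d | (v <= M)%MS].
Proof.
rewrite (_ : [set v | _] =
  (fun v : 'rV[R]_d => v *m cokermx M) @^-1` [set 0]); last first.
  by apply/seteqP; split => v /=; rewrite submxE => /eqP.
apply: closed_comp => [v _|]; first exact: mulmxr_continuous.
exact/accessible_closed_set1/hausdorff_accessible/norm_hausdorff.
Qed.

End topology.

Section affine_sets.
Context {R : realType} {d : nat}.
Implicit Types (A : set 'rV[R]_d) (u v x y z a : 'rV[R]_d).

Lemma affine_hull_affine A : affine_set (affine_hull A).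
Proof.
move=> x y t Ax Ay B AB; have [Baff _] := AB.
by apply: Baff; [exact: Ax|exact: Ay].
Qed.

(** Only two-point combinations are available: with [m] the midpoint of [x] and
    [q = (1 - t) *: z + t *: y], the wanted point is [2 m - z]. *)
Lemma affine_set_comb A x y z t : affine_set A -> A x -> A y -> A z ->
  A (x + t *: (y - z)).
Proof.
move=> Aaff Ax Ay Az.
have Aq : A ((1 - t) *: z + t *: y) by exact: Aaff.
have Am := Aaff _ _ 2^-1 Ax Aq.
have := Aaff _ _ 2 Az Am.
congr A; apply/rowP => i; by rewrite !mxE; field.
Qed.

Definition direction A := [set x - y | x in A & y in A].

Lemma directionE A a : affine_set A -> A a ->
  direction A = [set v | A (a + v)].
Proof.
move=> Aaff Aa; apply/seteqP; split => v /=.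
  by move=> [x Ax [y Ay <-]]; rewrite -[x - y]scale1r; exact: affine_set_comb.
by move=> Aav; exists (a + v) => //; exists a => //; rewrite addrC addKr.
Qed.

Lemma direction_submx A a : affine_set A -> A a ->
  exists r (M : 'M[R]_(r, d)), [/\ row_free M,
    (forall i, direction A (row i M)) &
    direction A = [set v | (v <= M)%MS]].
Proof.
move=> Aaff Aa.
have [r [M [Mfree MD DM]]] := exists_row_basis _ _ (direction A).
exists r, M; split => //; apply/seteqP; split => [v /DM//|v /submxP[c ->]] /=.
rewrite (directionE A a)//= mulmx_sum_row.
(* The terms are added one at a time, keeping the partial sums, translated by [a], inside [A]. *)
elim/big_ind : _ => [|u w Au Aw|i _]; first by rewrite addr0.
- have := affine_set_comb A (a + u) (a + w) a 1 Aaff Au Aw Aa.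
  by rewrite scale1r [a + w]addrC addrK addrA.
- have [x Ax [y Ay <-]] := MD i.
  exact: affine_set_comb.
Qed.

Lemma affine_set_closed A : affine_set A -> closed A.
Proof.
move=> Aaff; have [[a Aa]|] := pselect (A !=set0); last first.
  by move=> /set0P/negP/negPn/eqP ->; exact: closed0.
have [r [M [_ _ AM]]] := direction_submx A a Aaff Aa.
rewrite (_ : A = (fun x => x - a) @^-1` [set v | (v <= M)%MS]).
  apply: closed_comp => [x _|]; last exact: submx_closed.
  by apply: (@cvgB _ _ _ (nbhs x)); [exact: cvg_id|exact: cvg_cst].
by apply/seteqP; split => x; rewrite -AM (directionE A a)//= addrC subrK.
Qed.

Lemma direction_closed A : affine_set A -> closed (direction A).
Proof.
move=> Aaff; have [[a Aa]|A0] := pselect (A !=set0); last first.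
  rewrite (_ : direction A = set0); first exact: closed0.
  by rewrite -subset0 => v [x Ax]; case: A0; exists x.
have [r [M [_ _ ->]]] := direction_submx A a Aaff Aa.
exact: submx_closed.
Qed.

(* On the row space of M, the map v |-> v M^T has the inverse
   w |-> w (M M^T)^-1 M, so convergence can be tested on the rows of M. *)
Lemma direction_cvg A (u : nat -> 'rV[R]_d) : affine_set A ->
  (forall n, direction A (u n)) ->
  (forall z, direction A z -> cvgn (fun n => dotp (u n) z)) ->
  exists2 v, direction A v & u @ \oo --> v.
Proof.
move=> Aaff Au ucvg; have [a Aa _] := Au 0.
have [r [M [Mfree MD DM]]] := direction_submx A a Aaff Aa.
pose K := invmx (M *m M^T) *m M.
have uK n : u n = (u n *m M^T) *m K.
  have := Au n; rewrite DM /= => /submxP[c ->].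
  by rewrite /K -!mulmxA (mulmxA M) mulKVmx// gram_unit.
pose w : 'rV[R]_r := \row_i limn (fun n => dotp (u n) (row i M)).
have uw : (fun n => u n *m M^T) @ \oo --> w.
  apply: mx_cvg => i j; rewrite mxE.
  rewrite (_ : (fun n => _) = (fun n => dotp (u n) (row j M))).
    exact/ucvg/MD.
  by apply/funext => n; rewrite mxE; apply: eq_bigr => k _; rewrite !mxE ord1.
have uv : u @ \oo --> w *m K.
  rewrite (_ : u = (fun n => (u n *m M^T) *m K)); last exact/funext.
  exact: (cvg_comp _ _ uw (mulmxr_continuous _ _ K w)).
exists (w *m K) => //.
have := closed_cvg (direction A) (direction_closed A Aaff) _ _ uv.
by apply; exact: nearW.
Qed.

End affine_sets.

(** * Limits in variation *)

Section measure_theory.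
Local Open Scope ereal_scope.
Context {d} {T : measurableType d} {R : realType}.

(** By monotone convergence the sum of the series is integrable, hence finite almost everywhere;
    each term is bounded by the tail that it starts. *)
Lemma ae_cvg0_summable (mu : {measure set T -> \bar R})
    (g : nat -> T -> \bar R) :
  (forall n, measurable_fun [set: T] (g n)) -> (forall n x, 0 <= g n x) ->
  \sum_(n <oo) \int[mu]_x g n x < +oo ->
  {ae mu, forall x, g n x @[n --> \oo] --> 0}.
Proof.
move=> mg g0; rewrite -integral_nneseries// => gfin.
have mS : measurable_fun [set: T] (fun x => \sum_(n <oo) g n x).
  exact: ge0_emeasurable_sum.
have S0 x : 0 <= \sum_(n <oo) g n x by exact: nneseries_ge0.
have iS : mu.-integrable [set: T] (fun x => \sum_(n <oo) g n x).
  apply/integrableP; split => //.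
  by under eq_integral do rewrite gee0_abs//.
have := integrable_ae measurableT iS.
apply: filterS => x /(_ I) Sfin.
have Sy : \sum_(n <oo) g n x < +oo by rewrite ltey_eq Sfin.
have := @nneseries_tail_cvg R (fun n => g n x) xpredT Sy (fun n _ => g0 n x).
apply: (@squeeze_cvge _ _ _ _ (cst 0)); last exact: cvg_cst.
apply: nearW => n; rewrite g0/= (nneseries_split _ 1)//=.
by rewrite addn1 big_nat1 leeDl// nneseries_ge0.
Qed.

Section total_variation.
Implicit Types P Q : probability T R.

Lemma tv_dist_ge P Q (A : set T) : measurable A -> `|P A - Q A| <= tv_dist P Q.
Proof.
move=> mA; rewrite /tv_dist; set pos := cid _; set neg := cid _.
have := abse_charge_variation (svalP neg) mA.
move=> /le_trans; apply; apply: le_measure => //; rewrite ?inE//.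
Qed.

Lemma tv_dist_ge0 P Q : 0 <= tv_dist P Q.
Proof. exact: le_trans (tv_dist_ge P Q _ measurable0). Qed.

(** The two Jordan parts are, up to sign, the values of [P - Q] on the Hahn sets; the factor 2 comes
    from adding them. *)
Lemma tv_dist_le P Q (e : R) :
  (forall A, measurable A -> `|P A - Q A| <= e%:E) ->
  tv_dist P Q <= (2 * e)%:E.
Proof.
move=> PQe; rewrite /tv_dist; set pos := cid _; set neg := cid _.
have [[mN _] [mP _] _ _] := svalP neg.
rewrite /charge_variation jordan_posE jordan_negE.
rewrite cjordan_posE cjordan_negE.
rewrite /crestr0 mem_set//= /crestr !setTI.
rewrite mulr_natl mulr2n EFinD leeD//.
  exact: le_trans (lee_abs _) (PQe _ mN).
apply: le_trans (PQe _ mP).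
by rewrite -abseN; exact: lee_abs.
Qed.

(** The integral over the set where [g <= f] is a value of [P - Q], and over its complement a value
    of [Q - P]; each is at most the variation distance. *)
Lemma tv_dist_L1 (mu : {measure set T -> \bar R}) P Q (f g : T -> R) :
  mu.-integrable [set: T] (EFin \o f) -> mu.-integrable [set: T] (EFin \o g) ->
  (forall A, measurable A -> P A = \int[mu]_(x in A) (f x)%:E) ->
  (forall A, measurable A -> Q A = \int[mu]_(x in A) (g x)%:E) ->
  \int[mu]_x `|f x - g x|%:E <= tv_dist P Q + tv_dist P Q.
Proof.
move=> fi gi PE QE.
pose S := [set x | (g x)%:E <= (f x)%:E].
have mS : measurable S.
  rewrite -[S]setTI; apply: measurable_lee => //.
  - exact: measurable_int gi.
  - exact: measurable_int fi.
have mSC := measurableC mS.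
have mfg : measurable_fun [set: T] (fun x => `|f x - g x|%:E).
  apply/measurable_EFinP; apply: measurableT_comp => //.
  by apply: measurable_funB; apply/measurable_EFinP;
    [exact: measurable_int fi|exact: measurable_int gi].
rewrite -(setUv S) ge0_integral_setU//=; last 2 first.
- by rewrite setUv.
- by apply/disj_setPCl.
apply: leeD.
- rewrite (eq_integral (fun x => (f x)%:E - (g x)%:E)); last first.
    move=> x; rewrite inE /S/= lee_fin => gf.
    by rewrite ger0_norm// subr_ge0.
  rewrite integralB_EFin//; last 2 first.
  + exact: integrableS fi.
  + exact: integrableS gi.
  rewrite -PE// -QE//.
  exact: le_trans (lee_abs _) (tv_dist_ge _ _ _ mS).
- rewrite (eq_integral (fun x => (g x)%:E - (f x)%:E)); last first.
    move=> x; rewrite inE /S/= lee_fin => /negP; rewrite -ltNge => fg.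
    by rewrite ltr0_norm ?subr_lt0// opprB.
  rewrite integralB_EFin//; last 2 first.
  + exact: integrableS gi.
  + exact: integrableS fi.
  rewrite -PE// -QE//.
  apply: le_trans (tv_dist_ge _ _ _ mSC).
  rewrite -abseN fin_num_oppeB ?fin_num_measure// addeC.
  exact: lee_abs.
Qed.

Lemma ereal_small_index (a : nat -> \bar R) (e : R) : (0 < e)%R ->
  a n @[n --> \oo] --> 0%E -> exists n, (a n <= e%:E)%E.
Proof.
move=> e0 /(_ [set x | (x < e%:E)%E]) [].
  apply: open_nbhs_nbhs; split; first exact: open_ereal_lt_ereal.
  by rewrite /= lte_fin.
by move=> N _ /(_ N (leqnn _)) /= /ltW; exists N.
Qed.

Lemma density_dominates (mu : {measure set T -> \bar R}) (Q : set T -> \bar R)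
    (f : T -> R) : measurable_fun [set: T] f ->
  (forall A, measurable A -> Q A = \int[mu]_(x in A) (f x)%:E) -> Q `<< mu.
Proof.
move=> mf QE; apply/null_content_dominatesP => A mA muA.
rewrite QE//; apply: null_set_integral => //.
by apply: measurable_funTS; exact/measurable_EFinP.
Qed.

(** On a [mu]-null set every [Q n] vanishes, so the value of [P] there is bounded by arbitrarily
    small distances. *)
Lemma tv_limit_dominates (mu : {measure set T -> \bar R})
    (Q : nat -> probability T R)
    (P : probability T R) :
  (forall n, Q n `<< mu) -> tv_dist P (Q n) @[n --> \oo] --> 0%E -> P `<< mu.
Proof.
move=> Qmu PQ; apply/null_content_dominatesP => A mA muA.
apply/eqP; rewrite eq_le measure_ge0 andbT; apply/lee_addgt0Pr => e e0.
have [n] := ereal_small_index _ _ e0 PQ; rewrite add0e; apply: le_trans.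
have /null_content_dominatesP/(_ A mA muA) QA := Qmu n.
by have := tv_dist_ge P (Q n) A mA; rewrite QA sube0 gee0_abs.
Qed.

(** Domination passes to the limit, so Radon-Nikodym provides [p]. Along indices with fast enough
    convergence the L1 distances to [p] are summable, which gives convergence almost everywhere. *)
Lemma tv_limit_density (mu : {finite_measure set T -> \bar R})
    (Q : nat -> probability T R)
    (P : probability T R) (f : nat -> T -> R) :
  (forall n, mu.-integrable [set: _] (EFin \o f n)) ->
  (forall n A, measurable A -> Q n A = (\int[mu]_(x in A) (f n x)%:E)%E) ->
  tv_dist P (Q n) @[n --> \oo] --> 0%E ->
  exists p : T -> R, exists k : nat -> nat,
  [/\ mu.-integrable [set: _] (EFin \o p),
     (forall A, measurable A -> P A = (\int[mu]_(x in A) (p x)%:E)%E) &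
     {ae mu, forall x, f (k n) x @[n --> \oo] --> p x}].
Proof.
move=> fi QE PQ.
have mf n : measurable_fun [set: T] (f n).
  by apply/measurable_EFinP; exact: measurable_int (fi n).
have Pmu : P `<< mu.
  apply: (tv_limit_dominates mu Q) => // n.
  by apply: density_dominates (QE n); exact: mf.
have [g [g_ge0 gfin gi gE]] := radon_nikodym_sigma_finite Pmu.
pose p x := fine (g x).
have pE : EFin \o p = g by apply/funext => x /=; rewrite fineK.
have e0 n : (0 < (2 ^ n.+1)%:R^-1 :> R)%R by rewrite invr_gt0 ltr0n expn_gt0.
(* The index [k n] is any one at which the variation distance is at most [2^-(n+1)]; the resulting
   sequence need not increase. *)
have /choice[k kP] n := ereal_small_index _ _ (e0 n) PQ.
have ip : mu.-integrable [set: T] (EFin \o p) by rewrite pE.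
have pP A : measurable A -> P A = (\int[mu]_(x in A) (p x)%:E)%E.
  by move=> mA; rewrite gE// -pE.
exists p, k; split => //.
have mp : measurable_fun [set: T] p.
  by apply/measurable_EFinP; exact: measurable_int ip.
have := ae_cvg0_summable mu (fun n x => `|f (k n) x - p x|%:E).
have mfp n : measurable_fun [set: T] (fun x => `|f (k n) x - p x|%:E).
  apply/measurable_EFinP; apply: measurableT_comp => //.
  exact: measurable_funB.
move=> /(_ mfp) [].
- by move=> n x; rewrite lee_fin.
- apply: (@le_lt_trans _ _ (\sum_(n <oo) (2 / (2 ^ n.+1)%:R)%:E)%E); last first.
    by apply: le_lt_trans (epsilon_trick0 xpredT _) (ltry _).
  apply: lee_nneseries => [n _ _|n _]; first exact: integral_ge0.
  under eq_integral do rewrite distrC.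
  apply: le_trans (tv_dist_L1 mu P (Q (k n)) p (f (k n)) ip _ pP _) _ => //.
    exact: QE.
  by rewrite mulr_natl mulr2n EFinD leeD.
move=> N [mN N0 sN]; exists N; split => // x /= fx.
apply: sN => /= h; apply: fx.
apply/subr_cvg0/norm_cvg0P.
by move/fine_cvgP: h => [].
Qed.

End total_variation.
End measure_theory.

(** * Limits of exponential families *)

Section dotp.
Context {R : realType} {d : nat}.
Implicit Types u v w x y : 'rV[R]_d.

Lemma dotpDr u x y : dotp u (x + y) = dotp u x + dotp u y.
Proof. by rewrite -big_split/=; apply: eq_bigr => i _; rewrite mxE mulrDr. Qed.

Lemma dotpZr u x (t : R) : dotp u (t *: x) = t * dotp u x.
Proof. by rewrite mulr_sumr; apply: eq_bigr => i _; rewrite mxE mulrCA. Qed.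

Lemma dotpC u v : dotp u v = dotp v u.
Proof. by apply: eq_bigr => i _; rewrite mulrC. Qed.

Lemma dotpBr u x y : dotp u (x - y) = dotp u x - dotp u y.
Proof. by rewrite dotpDr -scaleN1r dotpZr mulN1r. Qed.

Lemma dotpDl u v x : dotp (u + v) x = dotp u x + dotp v x.
Proof. by rewrite !(dotpC _ x) dotpDr. Qed.

Lemma dotpZl u x (t : R) : dotp (t *: u) x = t * dotp u x.
Proof. by rewrite !(dotpC _ x) dotpZr. Qed.

Lemma dotpBl u v x : dotp (u - v) x = dotp u x - dotp v x.
Proof. by rewrite !(dotpC _ x) dotpBr. Qed.

Lemma dotp_continuous u : continuous (dotp u).
Proof.
apply: continuous_big => [|l _ v]; first exact: add_continuous.
by apply: (@cvgMl_tmp _ _ (nbhs v)); exact: coord_continuous.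
Qed.

Lemma dotp_cvgl (v : nat -> 'rV[R]_d) (u x : 'rV[R]_d) :
  v @ \oo --> u -> dotp (v n) x @[n --> \oo] --> dotp u x.
Proof.
move=> vu; rewrite dotpC; under eq_fun do rewrite dotpC.
exact: (cvg_comp _ _ vu (dotp_continuous x u)).
Qed.

Lemma open_measurable_rV (A : set 'rV[R]_d) :
  open A -> measurable (A : set (borelRd R d)).
Proof. by move=> oA; exact: sub_gen_smallest. Qed.

Lemma closed_measurable_rV (A : set 'rV[R]_d) :
  closed A -> measurable (A : set (borelRd R d)).
Proof.
by move=> /closed_openC/open_measurable_rV/measurableC; rewrite setCK.
Qed.

Lemma measurable_dotp u :
  measurable_fun [set: borelRd R d] (dotp u : borelRd R d -> R).
Proof.
apply: (measurability _ (RGenOpens.measurableE R)).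
move=> _ [_ [a [b ->] <-]]; rewrite setTI; apply: open_measurable_rV.
by move/continuousP: (@dotp_continuous u); apply; exact: interval_open.
Qed.

End dotp.

Section exponential_family.
Context {R : realType} {d : nat}.
Variable mu : {finite_measure set (borelRd R d) -> \bar R}.
Hypothesis mu_neq0 : mu [set: borelRd R d] <> 0%E.
Implicit Types (theta u : 'rV[R]_d) (Xi : set 'rV[R]_d).

(** An affine subspace is closed and convex, so one of full measure is among the sets intersected in
    [convex_support]. *)
Lemma affine_hull_convex_support_sub (A : set 'rV[R]_d) :
  affine_set A -> {ae mu, forall x, A x} ->
  affine_hull (convex_support mu) `<=` A.
Proof.
move=> Aaff muA; apply: smallest_sub => // x; apply.
have cA : closed A by exact: affine_set_closed.
have mA := closed_measurable_rV A cA.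
split => //.
  move=> a b t; rewrite !inE => Aa Ab.
  suff: A ((1 - t%:num) *: (b : 'rV[R]_d) + t%:num *: (a : 'rV[R]_d)).
    by rewrite addrC.
  exact: Aaff.
apply/esym; rewrite -(setUv A) measureU//; last 2 first.
- exact: measurableC.
- by rewrite setICr.
rewrite [X in (_ + X)%E](_ : _ = 0%E) ?adde0//.
by apply/negligibleP => //; exact: measurableC.
Qed.

Lemma measurable_expR_dotp u (c : R) :
  measurable_fun [set: borelRd R d]
    (fun x : borelRd R d => expR (dotp u x - c)).
Proof.
apply: measurableT_comp => //; apply: measurable_funB => //.
exact: measurable_dotp.
Qed.

(** The integrand is strictly positive. With [c] the value of [Lambda] at [u], this says that [mu]
    is dominated by the member of the family with parameter [u]. *)
Lemma integral_expR_eq0 u (c : R) (A : set (borelRd R d)) : measurable A ->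
  (\int[mu]_(x in A) (expR (dotp u x - c))%:E = 0)%E -> mu A = 0%E.
Proof.
move=> mA I0.
have mE : measurable_fun A (fun x : borelRd R d => (expR (dotp u x - c))%:E).
  apply: measurable_funTS; apply/measurable_EFinP.
  exact: measurable_expR_dotp.
have /(ae_eq_integral_abs mu mA mE)[N [mN N0 sN]] :
    (\int[mu]_(x in A) `|(expR (dotp u x - c))%:E| = 0)%E.
  rewrite -[RHS]I0; apply: eq_integral => x _.
  by rewrite gee0_abs// lee_fin expR_ge0.
apply/eqP; rewrite -measure_le0 -N0 le_measure ?inE// => x Ax.
apply: sN => /(_ Ax) /= [] /eqP; rewrite gt_eqF//.
exact: expR_gt0.
Qed.

Lemma integral_expR_gt0 u : (0 < \int[mu]_x (expR (dotp u x))%:E)%E.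
Proof.
rewrite lt_neqAle integral_ge0; last by move=> x _; rewrite lee_fin expR_ge0.
rewrite andbT eq_sym; apply/eqP => I0; apply: mu_neq0.
apply: (integral_expR_eq0 u 0) => //.
by rewrite -[RHS]I0; apply: eq_integral => x _; rewrite subr0.
Qed.

(** As [mu] is nonzero the integral is positive, and on the domain it is finite; thus [Lambda] is
    real there and [fine] loses nothing. *)
Lemma integral_expR_dom theta : dom_Lambda mu theta ->
  (\int[mu]_x (expR (dotp theta x))%:E = (expR (fine (Lambda mu theta)))%:E)%E.
Proof.
rewrite /dom_Lambda /Lambda /=.
have := integral_expR_gt0 theta.
case: (integral _ _ _) => [r||]//= r0 _.
by rewrite ifF ?lnK ?posrE// leNgt -lte_fin r0.
Qed.

Lemma integral_expR_Lambda theta (c : R) :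
  (\int[mu]_x (expR (dotp theta x))%:E = (expR c)%:E)%E ->
  Lambda mu theta = c%:E.
Proof. by rewrite /Lambda => ->; rewrite lne_EFin ?expR_gt0// expRK. Qed.

Lemma integral_expRB theta (c : R) (A : set (borelRd R d)) : measurable A ->
  (\int[mu]_(x in A) (expR (dotp theta x - c))%:E =
  (expR (- c))%:E * \int[mu]_(x in A) (expR (dotp theta x))%:E)%E.
Proof.
move=> mA.
rewrite -ge0_integralZl//; last first.
  apply: measurable_funTS; apply/measurable_EFinP.
  have := measurable_expR_dotp theta 0.
  by under eq_fun do rewrite subr0.
by apply: eq_integral => x _; rewrite -EFinM -expRD addrC.
Qed.

Lemma integrable_expR_dom theta (c : R) : dom_Lambda mu theta ->
  mu.-integrable [set: borelRd R d] (fun x => (expR (dotp theta x - c))%:E).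
Proof.
move=> dom; apply/integrableP; split.
  by apply/measurable_EFinP; exact: measurable_expR_dotp.
under eq_integral do rewrite gee0_abs ?lee_fin ?expR_ge0//.
by rewrite integral_expRB// integral_expR_dom// -EFinM ltry.
Qed.

(** The expression is affine in [x], so its set of convergence is an affine subspace and contains
    the hull of the support. Differences of hull points eliminate [c n], which gives the limit of
    [u]; the hull point [a] then gives the limit of [c]. *)
Lemma lin_cvg z0 (u : nat -> 'rV[R]_d) (c : nat -> R) : lin mu z0 ->
  (forall n, lin mu (u n)) ->
  {ae mu, forall x, cvgn (fun n => dotp (u n) x - c n)} ->
  exists theta (c0 : R), [/\ lin mu theta, u @ \oo --> theta & c @ \oo --> c0].
Proof.
move=> [a aS _] ulin ucvg.
pose A := [set x : 'rV[R]_d | cvgn (fun n => dotp (u n) x - c n)].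
have Aaff : affine_set A.
  move=> x y t Ax Ay; rewrite /A/=.
  rewrite (_ : (fun n => _) = (fun n => (1 - t) * (dotp (u n) x - c n) +
    t * (dotp (u n) y - c n))); last first.
    by apply/funext => n; rewrite dotpDr !dotpZr; ring.
  by apply: is_cvgD; apply: is_cvgMl_tmp.
have SA := affine_hull_convex_support_sub A Aaff ucvg.
have Saff := affine_hull_affine (convex_support mu).
have [|theta Dtheta utheta] := direction_cvg _ u Saff ulin.
  move=> z [x Sx [y Sy <-]].
  rewrite (_ : (fun n => _) = (fun n => (dotp (u n) x - c n) -
    (dotp (u n) y - c n))); last first.
    by apply/funext => n; rewrite dotpBr; ring.
  by apply: is_cvgB; [exact: (SA _ Sx)|exact: (SA _ Sy)].
have /cvg_ex[/= l al] : cvgn (fun n => dotp (u n) a - c n) := SA _ aS.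
exists theta, (dotp theta a - l); split => //.
rewrite (_ : c = (fun n => dotp (u n) a - (dotp (u n) a - c n))); last first.
  by apply/funext => n; ring.
by apply: cvgB; [exact: dotp_cvgl|exact: al].
Qed.

End exponential_family.

Section exponential_family.
Context {R : realType} {d : nat}.
Variable mu : {finite_measure set (borelRd R d) -> \bar R}.
Hypothesis mu_neq0 : mu [set: borelRd R d] <> 0%E.
Implicit Types (theta u : 'rV[R]_d) (Xi : set 'rV[R]_d).

(** The last hypothesis, [mu << P], makes the limit density positive [mu]-almost everywhere, so the
    log-densities have finite limits and [lin_cvg] applies. *)
Lemma tv_limit_expfam Xi (P : probability (borelRd R d) R) :
  Xi `<=` Theta mu -> variation_closure (expfam mu Xi) P ->
  (forall A, measurable A -> P A = 0%E -> mu A = 0%E) ->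
  expfam mu (closure Xi `&` Theta mu) P.
Proof.
move=> XiT [Q QXi PQ] muP.
have /choice[v vP] n : exists v, Xi v /\
    forall A, measurable A -> Q n A = Qtheta mu v A.
  by have [v ? ?] := QXi n; exists v.
have vXi n : Xi (v n) by have [] := vP n.
have vdom n : dom_Lambda mu (v n) by have [] := XiT _ (vXi n).
have vlin n : lin mu (v n) by have [] := XiT _ (vXi n).
have QE n A : measurable A -> Q n A = Qtheta mu (v n) A.
  by have [_] := vP n; apply.
have [p [k [ip PE fp]]] := tv_limit_density mu Q P _
  (fun n => integrable_expR_dom mu mu_neq0 (v n) _ (vdom n)) QE PQ.
have mp : measurable_fun [set: borelRd R d] p.
  by apply/measurable_EFinP; exact: measurable_int ip.
have p_gt0 : {ae mu, forall x, 0 < p x}.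
  (* [P N] is the integral of [p] over [N], hence at most zero; so [N] is [P]-null, and [mu]-null by
     [muP]. *)
  pose N := [set x | p x <= 0].
  have mN : measurable N.
    rewrite -[N]setTI [X in measurable (_ `&` X)](_ : _ = p @^-1` `]-oo, 0]).
      exact: mp.
    by apply/seteqP; split => x /=; rewrite in_itv/=.
  exists N; split => //; last by move=> x /= /negP; rewrite -leNgt.
  apply: muP => //; apply/eqP; rewrite eq_le measure_ge0 andbT.
  rewrite PE// -(integral0 mu N); apply: le_integral => //.
  - exact: integrableS ip.
  - exact: integrable0.
  - by move=> x; rewrite inE lee_fin.
have [|theta [c [thetalin vtheta Lc]]] := lin_cvg mu (v 0) (fun n => v (k n))
  (fun n => fine (Lambda mu (v (k n)))) (vlin 0) (fun n => vlin (k n)).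
  apply: filterS2 fp p_gt0 => x fpx px; apply/cvg_ex; exists (ln (p x)).
  rewrite (_ : (fun n => _) = (fun n =>
    ln (expR (dotp (v (k n)) x - fine (Lambda mu (v (k n))))))); last first.
    by apply/funext => n; rewrite expRK.
  exact: (cvg_comp _ _ fpx (continuous_ln px)).
have pE : {ae mu, forall x, p x = expR (dotp theta x - c)}.
  apply: filterS fp => x fpx.
  rewrite -(cvg_lim _ fpx)//; apply/cvg_lim => //.
  have h : dotp (v (k n)) x - fine (Lambda mu (v (k n))) @[n --> \oo] -->
      dotp theta x - c.
    by apply: cvgB => //; exact: (dotp_cvgl (fun n => v (k n))).
  exact: (cvg_comp _ _ h (@continuous_expR R _)).
have PE' A : measurable A ->
    P A = (\int[mu]_(x in A) (expR (dotp theta x - c))%:E)%E.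
  move=> mA; rewrite PE//; apply: ae_eq_integral => //.
  - by apply: measurable_funTS; exact/measurable_EFinP.
  - apply: measurable_funTS; apply/measurable_EFinP.
    exact: measurable_expR_dotp.
  - by apply: filterS pE => x -> .
(* The total mass of [P] is one, so [c] has to be the normalising constant of [theta]. *)
have LE : Lambda mu theta = c%:E.
  apply: integral_expR_Lambda.
  have := PE' _ measurableT; rewrite probability_setT integral_expRB// => h.
  by rewrite -[LHS]mul1e -[1%E](_ : (expR c)%:E * (expR (- c))%:E = _)%E
    -?muleA -?h ?mule1// -EFinM -expRD subrr expR0.
exists theta.
  split; last by split => //; rewrite /dom_Lambda/= LE ltry.
  apply: (closed_cvg (closure Xi) (@closed_closure _ Xi) _ _ vtheta).
  by apply: nearW => n; apply: subset_closure.
by move=> A mA; rewrite PE'// /Qtheta LE.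
Qed.

Lemma expfam_dominates theta (P : probability (borelRd R d) R) :
  (forall A, measurable A -> P A = Qtheta mu theta A) ->
  forall A, measurable A -> P A = 0%E -> mu A = 0%E.
Proof.
move=> PE A mA; rewrite PE//; exact: integral_expR_eq0.
Qed.

End exponential_family.

(** * I-divergence and variation distance *)

Section pinsker.
Local Open Scope charge_scope.
Local Open Scope ereal_scope.
Context {d} {T : measurableType d} {R : realType}.
Implicit Types P Q : probability T R.

(** Rays generate the Borel sets, and the preimage of the ray above [x] is the ray above [expR x],
    because [lne] is [-oo] on nonpositive arguments. *)
Lemma measurable_lne : measurable_fun [set: \bar R] (@lne R).
Proof.
apply: (measurability _ (ErealGenOInfty.measurableE R)) => _ [_ [x ->] <-].
rewrite setTI (_ : _ @^-1` _ = [set` `](expR x)%:E, +oo[]).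
  exact: emeasurable_itv.
apply/seteqP; split => -[r||] /=; rewrite ?in_itv/= ?andbT ?ltry// lte_fin.
- case: ifPn => [//|]; rewrite -ltNge lte_fin => r0 xr.
  by rewrite -[ltRHS]lnK ?posrE// ltr_expR.
- move=> xr; have r0 : (0 < r)%R := lt_trans (expR_gt0 _) xr.
  by rewrite leNgt r0/= lte_fin -ltr_expR lnK.
Qed.

Lemma ereal_cvg0 (a : nat -> \bar R) : (forall n, 0 <= a n) ->
  (forall e : R, (0 < e)%R -> \forall n \near \oo, a n <= e%:E) ->
  a n @[n --> \oo] --> 0.
Proof.
move=> a0 ae; apply/fine_cvgP; split.
  have := ae 1%R ltr01; apply: filterS => n a1.
  by rewrite ge0_fin_numE// (le_lt_trans a1) ?ltry.
apply/cvgr0Pnorm_le => e e0.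
have := ae e e0; apply: filterS => n an /=.
rewrite ger0_norm ?fine_ge0// -lee_fin fineK//.
by rewrite ge0_fin_numE// (le_lt_trans an) ?ltry.
Qed.

(* L is a version of ln (dQ/dP) with values in R: the set where dQ/dP vanishes
   is Q-null, and L is set to 0 there. *)
Lemma Idiv_density Q P : Q `<< P ->
  exists L : T -> R, [/\ measurable_fun [set: T] L,
    Idiv Q P = \int[Q]_x (L x)%:E &
    forall k : T -> R, measurable_fun [set: T] k -> (forall x, (0 <= k x)%R) ->
      \int[Q]_x (k x * expR (- L x))%:E <= \int[P]_x (k x)%:E].
Proof.
move=> QP.
pose g := Radon_Nikodym_SigmaFinite.f Q P.
have g0 : forall x, 0 <= g x by exact: Radon_Nikodym_SigmaFinite.f_ge0.
have gfin : forall x, g x \is a fin_num.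
  exact: Radon_Nikodym_SigmaFinite.f_fin_num.
have gi : P.-integrable [set: T] g.
  exact: Radon_Nikodym_SigmaFinite.f_integrable.
have mg : measurable_fun [set: T] g by exact: measurable_int gi.
have mfg : measurable_fun [set: T] (fun x => fine (g x)).
  exact: measurableT_comp.
pose w x := (if 0 < fine (g x) then fine (g x) else 1)%R.
have mw : measurable_fun [set: T] w.
  apply: measurable_fun_ifT => //; exact: measurable_fun_ltr.
have w0 x : (0 < w x)%R by rewrite /w; case: ifPn.
have mL : measurable_fun [set: T] (fun x => ln (w x)).
  exact: measurableT_comp.
exists (fun x => ln (w x)); split => //.
- rewrite /Idiv asboolT//; apply: ae_eq_integral => //.
  + by apply: measurableT_comp => //; exact: measurable_lne.
  + by apply/measurable_EFinP; exact: measurableT_comp.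
  + have gq : ae_eq Q [set: T] g ('d (charge_of_finite_measure Q) '/d P).
      by apply: (null_dominates_ae_eq measurableT QP);
        exact: ae_eq_Radon_Nikodym_SigmaFinite.
    have Qg : {ae Q, forall x, (0 < fine (g x))%R}.
      pose N := [set x | g x = 0].
      have mN : measurable N.
        by rewrite -[N]setTI; exact: (mg measurableT _ (emeasurable_set1 0)).
      exists N; split => //.
        rewrite (Radon_Nikodym_SigmaFinite.f_integral QP)//.
        by rewrite -(integral0 P N); apply: eq_integral => x; rewrite inE.
      move=> x /= /negP; rewrite -leNgt => gx; apply/eqP.
      by rewrite eq_le g0 -[g x]fineK// lee_fin gx.
    apply: filterS2 gq Qg => x /(_ I) <- gx _.
    by rewrite -[in LHS](fineK (gfin x)) lne_EFin// /w gx.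
- move=> k mk k0.
  have mkw : measurable_fun [set: T] (fun x => (k x * expR (- ln (w x)))%:E).
    apply/measurable_EFinP; apply: measurable_funM => //.
    apply: measurableT_comp => //; exact: measurableT_comp.
  (* Under [P] the integrand becomes [k * g / w]: it equals [k] where [g] is positive and vanishes
     elsewhere, whence only an inequality. *)
  rewrite -(Radon_Nikodym_SigmaFinite.change_of_variables QP)//; last first.
    by move=> x; rewrite lee_fin mulr_ge0// expR_ge0.
  apply: ge0_le_integral => //.
  + by move=> x _; rewrite mule_ge0// lee_fin mulr_ge0// expR_ge0.
  + exact: emeasurable_funM.
  + exact/measurable_EFinP.
  + move=> x _; rewrite -[X in _ * X]fineK// -EFinM lee_fin.
    rewrite expRN lnK ?posrE// /w; case: ifPn => [gx|].
      by rewrite divfK// gt_eqF.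
    rewrite -leNgt => gx; rewrite (_ : fine _ = 0%R) ?mulr0//.
    by apply/eqP; rewrite eq_le gx fine_ge0.
Qed.


(** The negative part is at most [h], so its integral is finite; an integral of [f] below [+oo] then
    forces the positive part to have a finite integral too. *)
Lemma integrable_lower_bounded (mu : {measure set T -> \bar R}) (f h : T -> R) :
  measurable_fun [set: T] f -> mu.-integrable [set: T] (EFin \o h) ->
  (forall x, - f x <= h x)%R -> \int[mu]_x (f x)%:E < +oo ->
  (forall x, 0 <= h x)%R ->
  mu.-integrable [set: T] (EFin \o f).
Proof.
move=> mf ih fh If h0.
have mEf : measurable_fun [set: T] (EFin \o f) by exact/measurable_EFinP.
have Ineg : \int[mu]_x (EFin \o f)^\- x < +oo.
  apply: le_lt_trans (integrable_lty _ ih) => //.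
  apply: ge0_le_integral => //.
  - exact: measurable_funeneg.
  - exact: measurable_int ih.
  - by move=> x _; rewrite funenegE /= -EFin_max lee_fin ge_max fh h0.
have Ipos : \int[mu]_x (EFin \o f)^\+ x < +oo.
  have := If; rewrite integralE.
  have : 0 <= \int[mu]_x (EFin \o f)^\- x by exact: integral_ge0.
  move: Ineg.
  case: (\int[mu]_x (EFin \o f)^\- x) => [r||];
    case: (\int[mu]_x (EFin \o f)^\+ x) => [s||] //= *; exact: ltry.
apply/integrableP; split => //.
rewrite [X in \int[mu]_x X x](fune_abse (EFin \o f)).
rewrite ge0_integralD//; last 2 first.
- exact: measurable_funepos.
- exact: measurable_funeneg.
exact: lte_add_pinfty.
Qed.

(** From [expR (- l) >= 1 - l] follows [expR l <= 1 / (1 - l)], and [(1 + l + 2 l^2) (1 - l) = 1 +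
    l^2 (1 - 2 l) >= 1]. *)
Lemma expR_le_quadratic (l : R) :
  (0 <= l <= 2^-1 -> expR l - 1 <= l + 2 * l ^+ 2)%R.
Proof.
move=> /andP[l0 l2]; rewrite -[l in expR l]opprK expRN.
have e0 : (0 < 1 - l)%R by lra.
have : ((expR (- l))^-1 <= (1 - l)^-1)%R.
  by rewrite lef_pV2 ?posrE ?expR_gt0//; exact: expR_ge1Dx.
move=> /le_trans h; rewrite lerBlDr; apply: h.
rewrite -div1r ler_pdivrMr//.
have l2' : (0 <= 1 - 2 * l)%R by lra.
by have := mulr_ge0 (sqr_ge0 l) l2'; nra.
Qed.

(* Variational lower bound on the divergence, tested on l times the indicator
   of B. *)
Lemma Idiv_diff_le Q P (r l : R) (B : set T) : Q `<< P ->
  Idiv Q P <= r%:E -> (0 < l <= 2^-1)%R -> measurable B ->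
  (l * (fine (Q B) - fine (P B)) <= r + 2 * l ^+ 2)%R.
Proof.
move=> QP Dr /andP[l0 l2] mB.
have [L [mL DE Lk]] := Idiv_density Q P QP.
have mLE (k : T -> R) : measurable_fun [set: T] k ->
    measurable_fun [set: T] (fun x => k x * expR (- L x))%R.
  move=> mk; apply: measurable_funM => //.
  by apply: measurableT_comp => //; exact: measurableT_comp.
have ikL (k : T -> R) : measurable_fun [set: T] k -> (forall x, 0 <= k x)%R ->
    P.-integrable [set: T] (EFin \o k) ->
    Q.-integrable [set: T] (EFin \o (fun x => k x * expR (- L x))%R).
  move=> mk k0 ik; apply/integrableP; split; first exact/measurable_EFinP/mLE.
  under eq_integral do rewrite gee0_abs ?lee_fin ?mulr_ge0 ?expR_ge0//=.
  exact: le_lt_trans (Lk k mk k0) (integrable_lty _ ik).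
(* [- L] is at most [expR (- L)], whose [Q]-integral is at most one by [Lk] for the constant 1. *)
have iL : Q.-integrable [set: T] (EFin \o L).
  apply: (integrable_lower_bounded _ _ (fun x => 1 * expR (- L x))%R) => //.
  - apply: (ikL (cst 1%R)) => //; exact: finite_measure_integrable_cst.
  - by move=> x; rewrite mul1r (le_trans _ (expR_ge1Dx _))// lerDr.
  - by rewrite -DE (le_lt_trans Dr) ?ltry.
(* This is the exponential of [l * \1_B], written linearly in the indicator so that its integral is
   explicit. *)
pose k x := (1 + (expR l - 1) * \1_B x)%R.
have el : (0 <= expR l - 1)%R.
  by rewrite subr_ge0 (le_trans _ (expR_ge1Dx _))// lerDl ltW.
have mk : measurable_fun [set: T] k.
  by apply: measurable_funD => //; apply: measurable_funM.
have k0 x : (0 <= k x)%R by rewrite addr_ge0 ?mulr_ge0.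
have i1 (M : probability T R) c :
    M.-integrable [set: T] (EFin \o (fun x => 1 + c * \1_B x)%R).
  rewrite [X in integrable _ _ X](_ : _ =
    cst 1 \+ (fun x => c%:E * (\1_B x)%:E))//.
  apply: integrableD => //; first exact: finite_measure_integrable_cst.
  by apply: integrableZl => //; exact: integrable_indic.
have I1 (M : probability T R) c :
    \int[M]_x (1 + c * \1_B x)%:E = (1 + c * fine (M B))%:E.
  under eq_integral do rewrite EFinD EFinM.
  rewrite integralD//=; last 2 first.
  - exact: finite_measure_integrable_cst.
  - by apply: integrableZl => //; exact: integrable_indic.
  rewrite integral_cst// mul1e [X in X + _](_ : _ = 1); last first.
    exact: probability_setT.
  rewrite integralZl//; last exact: integrable_indic.
  by rewrite integral_indic// setIT EFinD EFinM fineK// fin_num_measure.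
(* Pointwise this is [1 + z <= expR z] at [z = l * \1_B x - L x]. *)
have ineq : \int[Q]_x (1 + l * \1_B x)%:E <=
    \int[Q]_x ((k x * expR (- L x))%:E + (L x)%:E).
  apply: le_integral => //; first exact: i1.
  - by apply: integrableD => //; apply: ikL => //; exact: i1.
  - move=> x _; rewrite -EFinD lee_fin /k indicE.
    case: (x \in B); rewrite ?mulr1 ?mulr0 ?addr0.
      rewrite addrCA subrr addr0 -expRD.
      by have := expR_ge1Dx (l - L x); lra.
    by rewrite mul1r; have := expR_ge1Dx (- L x); lra.
move: ineq; rewrite I1 integralD//=; last by apply: ikL => //; exact: i1.
move=> /le_trans/(_ (leeD (Lk k mk k0) (lexx _))).
rewrite [X in _ <= X + _ -> _](I1 P (expR l - 1)%R) -DE.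
move=> /le_trans/(_ (leeD (lexx _) Dr)).
rewrite -EFinD lee_fin => h.
have := expR_le_quadratic l; rewrite (ltW l0) l2 => /(_ isT) hl.
have PB0 : (0 <= fine (P B))%R by rewrite fine_ge0.
have PB1 : (fine (P B) <= 1)%R.
  by rewrite -lee_fin fineK ?fin_num_measure// probability_le1.
have := ler_wpM2r PB0 hl.
nra.
Qed.

(** Dividing [Idiv_diff_le] by [l] bounds [Q B - P B]; the complement of [B] gives the opposite
    sign. *)
Lemma Idiv_tv_le Q P (r l : R) : Q `<< P ->
  Idiv Q P <= r%:E -> (0 < l <= 2^-1)%R ->
  tv_dist P Q <= (2 * (r / l + 2 * l))%:E.
Proof.
move=> QP Dr l2; have l0 : (0 < l)%R by case/andP: l2.
have bound B : measurable B -> (fine (Q B) - fine (P B) <= r / l + 2 * l)%R.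
  move=> mB; have := Idiv_diff_le Q P r l B QP Dr l2 mB.
  rewrite mulrC -ler_pdivlMr// => /le_trans; apply.
  by rewrite mulrDl lerD2l expr2 mulrA mulfK// gt_eqF.
apply: tv_dist_le => B mB.
rewrite -(fineK (fin_num_measure P B mB)) -(fineK (fin_num_measure Q B mB)).
rewrite -EFinB lee_fin ler_norml; apply/andP; split.
  by have := bound _ mB; lra.
have := bound _ (measurableC mB).
rewrite !probability_setC// !fineB ?fin_num_measure//=; lra.
Qed.

(** The second conclusion serves to derive [mu << P], since [mu] is dominated by every member of the
    exponential family. *)
Lemma I_closure_variation_closure (S : set (probability T R)) P :
  I_closure S P ->
  variation_closure S P /\ exists2 Q, S Q & Q `<< P.
Proof.
move=> [Q SQ DQ].
have Dn (e : R) : (0 < e)%R -> \forall n \near \oo, Idiv (Q n) P <= e%:E.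
  move=> e0; have := DQ [set x | x < e%:E].
  have /[swap] /[apply] : nbhs (0 : \bar R) [set x | x < e%:E].
    apply: open_nbhs_nbhs; split; first exact: open_ereal_lt_ereal.
    by rewrite /= lte_fin.
  by move=> [N _ DN]; exists N => // n Nn; exact/ltW/(DN n Nn).
(* Without domination [Idiv] takes the value [+oo], which no real [r] bounds. *)
have QP n (r : R) : Idiv (Q n) P <= r%:E -> Q n `<< P.
  by rewrite /Idiv; case: ifPn => [/asboolP//|_]; rewrite leye_eq.
split; last by have [N _ /(_ N (leqnn _))/QP] := Dn 1%R ltr01; exists (Q N).
exists Q => //; apply: ereal_cvg0 => [n|e e0]; first exact: tv_dist_ge0.
(* For [r = l * l] the variation bound is [2 * (l + 2 * l) = 6 * l], hence the choice [e / 6]. *)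
pose l := (Num.min 2^-1 (e / 6))%R.
have l0 : (0 < l)%R by rewrite lt_min invr_gt0 ltr0n divr_gt0.
have := Dn (l * l)%R (mulr_gt0 l0 l0); apply: filterS => n Dl.
apply: le_trans (Idiv_tv_le _ _ (l * l) l (QP _ _ Dl) Dl _) _.
  by rewrite l0 ge_min lexx.
rewrite lee_fin mulfK ?gt_eqF//.
have : (l <= e / 6)%R by rewrite ge_min lexx orbT.
lra.
Qed.

End pinsker.

(** * Convex parameter sets *)

Section convex_sets.
Context {R : realType} {d : nat}.
Implicit Types (A : set 'rV[R]_d) (x y : 'rV[R]_d).

Lemma convex_set_comb A x y (t : R) : convex_set A -> A x -> A y ->
  0 <= t <= 1 -> A ((1 - t) *: x + t *: y).
Proof.
move=> Aconv Ax Ay t01.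
have := Aconv y x (Itv01 (andP t01).1 (andP t01).2) (mem_set Ay) (mem_set Ax).
by rewrite inE addrC.
Qed.

(** The first row gets weight [c i] and the rest is rescaled by [1 - c i], positive because the sum
    is strictly below one; [x] takes the leftover weight. *)
Lemma convex_set_sum A x (r : nat) (M : 'M[R]_(r, d)) (s : seq 'I_r)
    (c : 'I_r -> R) : convex_set A -> A x -> (forall i, A (x + row i M)) ->
  (forall i, 0 <= c i) -> \sum_(i <- s) c i < 1 ->
  A (x + \sum_(i <- s) c i *: row i M).
Proof.
move=> Aconv Ax AM; elim: s c => [|i s IHs] c c0.
  by rewrite !big_nil addr0.
rewrite !big_cons => c1.
have s0 : 0 <= \sum_(j <- s) c j by exact: sumr_ge0.
have ci1 : 0 < 1 - c i by lra.
have := IHs (fun j => c j / (1 - c i)).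
rewrite -mulr_suml ltr_pdivrMr// mul1r => IH.
have /IH h : forall j, 0 <= c j / (1 - c i) by move=> j; rewrite divr_ge0// ltW.
have /h {}h : \sum_(j <- s) c j < 1 - c i by lra.
have ci01 : 0 <= c i <= 1 by rewrite c0/=; lra.
have := convex_set_comb _ _ _ (c i) Aconv h (AM i) ci01.
congr A; rewrite !scalerDr scaler_sumr.
rewrite (eq_bigr (fun j => c j *: row j M)) => [|j _]; last first.
  by rewrite scalerA mulrC divfK// gt_eqF.
rewrite addrACA -scalerDl subrK scale1r; congr (_ + _).
by rewrite addrC.
Qed.

(* The point y is the barycentre of an affinely independent family of maximal
   size in A: it belongs to the relative interior of A. *)
Lemma convex_set_segment A x : convex_set A -> closure A x ->
  exists y, forall t, 0 < t <= 1 -> A ((1 - t) *: x + t *: y).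
Proof.
move=> Aconv clx.
have [a Aa] : A !=set0 by have [a [Aa _]] := clx _ filterT; exists a.
have [r [M [Mfree MA AM]]] := exists_row_basis _ _ [set y - a | y in A].
have AaM i : A (a + row i M).
  by have [y Ay <-] := MA i; rewrite addrC subrK.
(* The common weight of the [r + 1] points [a] and [a + row i M] in their barycentre. *)
pose b : R := r.+1%:R^-1.
have b0 : 0 < b by rewrite invr_gt0 ltr0n.
exists (a + const_mx b *m M) => t /andP[t0 t1].
have xM : (x - a <= M)%MS.
  have cM : closed ((fun y => y - a) @^-1` [set v | (v <= M)%MS]).
    apply: closed_comp => [y _|]; last exact: submx_closed.
    by apply: (@cvgB _ _ _ (nbhs y)); [exact: cvg_id|exact: cvg_cst].
  apply: cM; apply: closure_subset clx => y Ay /=.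
  by apply: AM; exists y.
pose K := pinvmx M.
(* This closeness of [y] to [x], in coordinates along [M], survives multiplication by [(1 - t) / t]
   as a bound [b ^+ 2]. *)
have e0 : 0 < t * b ^+ 2 by rewrite mulr_gt0// exprn_gt0.
have [y [Ay xy]] : exists y, A y /\
    forall j, `|((x - y) *m K) ord0 j| < t * b ^+ 2.
  have xK : (fun y : 'rV[R]_d => (x - y) *m K) y @[y --> x] --> (0 : 'rV[R]_r).
    rewrite -[X in _ --> X](mul0mx _ K) -[X in X *m K](subrr x).
    have xx : (fun y => x - y) y @[y --> x] --> x - x.
      by apply: (@cvgB _ _ _ (nbhs x)); [exact: cvg_cst|exact: cvg_id].
    exact: (cvg_comp _ _ xx (mulmxr_continuous _ _ K (x - x))).
  have /cvg_ball/(_ _ e0) := xK.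
  move=> /clx[y [Ay [_ xy]]]; exists y; split => // j.
  by have := xy ord0 j; rewrite /ball/= mxE sub0r normrN.
pose c := (x - y) *m K.
have cE : c *m M = x - y.
  rewrite mulmxKpV//.
  rewrite (_ : x - y = (x - a) - (y - a)); last by rewrite opprB addrA subrK.
  by rewrite addmx_sub// eqmx_opp; apply: AM; exists y.
(* Replacing [x] by the nearby [y] in [A] is compensated by shifting the barycentre by [(1 - t) / t]
   times [x - y]; [w] are the shifted weights. *)
pose w i := b + (1 - t) / t * c ord0 i.
have wE : (1 - t) *: x + t *: (a + const_mx b *m M) =
    (1 - t) *: y + t *: (a + \sum_i w i *: row i M).
  have -> : \sum_i w i *: row i M = const_mx b *m M + ((1 - t) / t) *: (x - y).
    rewrite -cE scalemxAl -mulmxDl mulmx_sum_row.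
    by apply: eq_bigr => i _; rewrite /w !mxE.
  rewrite addrA [in RHS]scalerDr scalerA mulrCA mulfV ?gt_eqF// mulr1.
  by rewrite scalerBr addrCA [X in _ = _ + X]addrCA subrr addr0 [LHS]addrC.
rewrite wE; apply: convex_set_comb => //; last by rewrite ltW.
have cb i : (1 - t) / t * `|c ord0 i| <= b ^+ 2.
  rewrite mulrAC ler_pdivrMr// mulrC [leRHS]mulrC -[leRHS]mulr1.
  by apply: ler_pM => //; [lra|exact/ltW/xy|lra].
have tt : 0 <= (1 - t) / t by apply: divr_ge0; lra.
have wb i : `|w i - b| <= b ^+ 2.
  by rewrite /w addrC addKr normrM (ger0_norm tt).
have rb : r.+1%:R * b = 1 by rewrite mulfV// pnatr_eq0.
have b1 : b ^+ 2 <= b.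
  by rewrite expr2 ler_piMl ?(ltW b0)// /b invf_le1 ?ltr0n// ler1n.
apply: convex_set_sum => // [i|].
  by have := wb i; rewrite ler_norml => /andP[+ _]; lra.
(* As [r = 1 / b - 1], the bound [r * (b + b ^+ 2)] equals [1 - b ^+ 2]. *)
apply: (@le_lt_trans _ _ (\sum_(i < r) (b + b ^+ 2))).
  apply: ler_sum => i _; have := wb i; rewrite ler_norml => /andP[_ +]; lra.
rewrite sumr_const card_ord -[_ *+ r]mulr_natl.
have -> : r%:R = r.+1%:R - 1 :> R by rewrite -[r.+1]addn1 natrD addrK.
nra.
Qed.

End convex_sets.

(** * Probability measures given by densities *)

Section density.
Local Open Scope charge_scope.
Local Open Scope ereal_scope.
Context {d} {T : measurableType d} {R : realType}.
Variable mu : {finite_measure set T -> \bar R}.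

(* The unused proofs are arguments so that the measure and probability
   instances below can be inferred from the term. *)
Definition density_measure (f : T -> R) (mf : measurable_fun [set: T] f)
    (f0 : forall x, (0 <= f x)%R) (f1 : \int[mu]_x (f x)%:E = 1) :
    set T -> \bar R :=
  fun A => \int[mu]_(x in A) (f x)%:E.

Section instance.
Context (f : T -> R) (mf : measurable_fun [set: T] f).
Context (f0 : forall x, (0 <= f x)%R) (f1 : \int[mu]_x (f x)%:E = 1).
Let m := density_measure f mf f0 f1.

Let m0 : m set0 = 0. Proof. exact: integral_set0. Qed.

Let m_ge0 A : 0 <= m A.
Proof. by apply: integral_ge0 => x _; rewrite lee_fin. Qed.

Let m_sigma_additive : semi_sigma_additive m.
Proof.
move=> F mF tF mUF; rewrite /m /density_measure; apply: cvg_toP.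
  apply: ereal_nondecreasing_is_cvgn => n k nk.
  by apply: lee_sum_nneg_natr => // i _ _; exact: m_ge0.
rewrite ge0_integral_bigcup//=.
- by apply: measurable_funTS; exact/measurable_EFinP.
- by move=> x _; rewrite lee_fin.
Qed.

HB.instance Definition _ := isMeasure.Build _ _ _ (density_measure f mf f0 f1)
  m0 m_ge0 m_sigma_additive.

Let mT : m [set: T] = 1. Proof. exact: f1. Qed.

HB.instance Definition _ := @Measure_isProbability.Build _ _ R
  (density_measure f mf f0 f1) mT.

End instance.

Lemma density_probability (f : T -> R) :
  measurable_fun [set: T] f -> (forall x, (0 <= f x)%R) ->
  \int[mu]_x (f x)%:E = 1 ->
  exists P : probability T R, forall A, P A = \int[mu]_(x in A) (f x)%:E.
Proof.
by move=> mf f0 f1; exists (density_measure f mf f0 f1 : probability T R).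
Qed.

(** The Radon-Nikodym derivative of [P] and [f] have equal integrals over all measurable subsets of
    [A], so they agree almost everywhere on it. *)
Lemma integral_density (P : probability T R) (f h : T -> R) (A : set T) :
  mu.-integrable [set: T] (EFin \o f) ->
  (forall B, measurable B -> P B = \int[mu]_(x in B) (f x)%:E) ->
  measurable A -> measurable_fun [set: T] h -> (forall x, 0 <= h x)%R ->
  \int[P]_(x in A) (h x)%:E = \int[mu]_(x in A) (h x * f x)%:E.
Proof.
move=> fi PE mA mh h0.
have mf : measurable_fun [set: T] f.
  by apply/measurable_EFinP; exact: measurable_int fi.
have Pmu : P `<< mu by exact: density_dominates PE.
rewrite -(Radon_Nikodym_SigmaFinite.change_of_variables Pmu)//; last first.
  by apply: measurable_funTS; exact/measurable_EFinP.
have mg := measurable_int _ (Radon_Nikodym_SigmaFinite.f_integrable Pmu).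
apply: ae_eq_integral => //.
- apply: emeasurable_funM; apply: measurable_funTS => //.
  exact/measurable_EFinP.
- apply: measurable_funTS; apply/measurable_EFinP; exact: measurable_funM.
have : ae_eq mu A (Radon_Nikodym_SigmaFinite.f P mu) (EFin \o f).
  apply: integral_ae_eq => //.
  - apply: (integrableS measurableT) => //.
    exact: Radon_Nikodym_SigmaFinite.f_integrable.
  - by apply: measurable_funTS; exact/measurable_EFinP.
  - move=> B _ mB; rewrite -Radon_Nikodym_SigmaFinite.f_integral//.
    exact: PE.
by apply: filterS => x /= h1 /h1 ->.
Qed.

End density.

(** * Divergence along segments of parameters *)

Section exponential_family.
Local Open Scope charge_scope.
Context {R : realType} {d : nat}.
Variable mu : {finite_measure set (borelRd R d) -> \bar R}.
Hypothesis mu_neq0 : mu [set: borelRd R d] <> 0%E.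
Implicit Types (theta tau : 'rV[R]_d) (Xi : set 'rV[R]_d).

Lemma expfam_probability theta : dom_Lambda mu theta ->
  exists P : probability (borelRd R d) R,
    forall A, measurable A -> P A = Qtheta mu theta A.
Proof.
move=> dom.
have [||P PE] := density_probability mu _
  (measurable_expR_dotp theta (fine (Lambda mu theta))).
- by move=> x; rewrite expR_ge0.
- rewrite integral_expRB// integral_expR_dom//.
  by rewrite -EFinM -expRD addrC subrr expR0.
- by exists P => A _; rewrite PE.
Qed.

(* With u = ln (dQ/dP), the two bounds integrate 1 - exp (- u) <= u <= exp u - 1
   against Q. *)
Lemma Idiv_expfam_le theta tau (P Q : probability (borelRd R d) R) :
  dom_Lambda mu theta -> dom_Lambda mu tau ->
  dom_Lambda mu (2 *: tau - theta) ->
  (forall A, measurable A -> P A = Qtheta mu theta A) ->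
  (forall A, measurable A -> Q A = Qtheta mu tau A) ->
  (0 <= Idiv Q P <= (expR (fine (Lambda mu (2 *: tau - theta)) +
    fine (Lambda mu theta) - 2 * fine (Lambda mu tau)) - 1)%:E)%E.
Proof.
move=> dtheta dtau drho PE QE.
set Lt := fine (Lambda mu theta) in PE *.
set Lu := fine (Lambda mu tau) in QE *.
set Lr := fine (Lambda mu (2 *: tau - theta)) in drho *.
pose u (x : borelRd R d) := dotp (tau - theta) x - (Lu - Lt).
have mu_u : measurable_fun [set: borelRd R d] u.
  by apply: measurable_funB => //; exact: measurable_dotp.
have meu (v : borelRd R d -> R) : measurable_fun [set: borelRd R d] v ->
    measurable_fun [set: borelRd R d] (fun x => expR (v x)).
  by move=> mv; exact: measurableT_comp.
have iP := integrable_expR_dom mu mu_neq0 theta Lt dtheta.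
have iQ := integrable_expR_dom mu mu_neq0 tau Lu dtau.
have mNu : measurable_fun [set: borelRd R d] (fun x => - u x).
  exact: measurableT_comp.
have QPE A : measurable A -> Q A = (\int[P]_(x in A) (expR (u x))%:E)%E.
  move=> mA; rewrite (integral_density mu P _ _ A iP PE)//; last first.
    exact: meu.
  rewrite QE//; apply: eq_integral => x _; rewrite -expRD /u; congr (expR _)%:E.
  by rewrite dotpBl -/Lu; ring.
have QP : Q `<< P by apply: (density_dominates P) QPE; exact: meu.
(* Multiplying the density of [Q] by [expR u] produces the exponent with parameter
   [2 *: tau - theta], whose integral is known. *)
have IeU : (\int[Q]_x (expR (u x))%:E = (expR (Lr + Lt - 2 * Lu))%:E)%E.
  rewrite (integral_density mu Q _ _ _ iQ QE)//; last exact: meu.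
  rewrite (eq_integral (fun x : borelRd R d =>
      (expR (dotp (2 *: tau - theta) x - (2 * Lu - Lt)))%:E)).
    rewrite integral_expRB// integral_expR_dom// -EFinM -expRD -/Lr.
    by congr (expR _)%:E; ring.
  move=> x _; rewrite -expRD; congr (expR _)%:E.
  by rewrite /u !dotpBl dotpZl; ring.
have IeNU : (\int[Q]_x (expR (- u x))%:E = 1)%E.
  rewrite (integral_density mu Q _ _ _ iQ QE)//; last exact: meu.
  transitivity (P [set: borelRd R d]); last exact: probability_setT.
  rewrite PE//; apply: eq_integral => x _; rewrite -expRD /u; congr (expR _)%:E.
  by rewrite !dotpBl -/Lt; ring.
have ieU : Q.-integrable [set: borelRd R d] (fun x => (expR (u x))%:E).
  apply/integrableP; split; first by apply/measurable_EFinP; exact: meu.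
  under eq_integral do rewrite gee0_abs ?lee_fin ?expR_ge0//.
  by rewrite IeU ltry.
have ieNU : Q.-integrable [set: borelRd R d] (fun x => (expR (- u x))%:E).
  apply/integrableP; split; first by apply/measurable_EFinP; exact: meu.
  under eq_integral do rewrite gee0_abs ?lee_fin ?expR_ge0//.
  by rewrite IeNU ltry.
(* Both [u] and [- u] are below the sum of the two exponentials. *)
have iU : Q.-integrable [set: borelRd R d] (EFin \o u).
  apply: le_integrable (integrableD measurableT ieU ieNU) => //.
    exact/measurable_EFinP.
  move=> x _; rewrite -EFinD /= lee_fin [leRHS]ger0_norm ?addr_ge0 ?expR_ge0//.
  rewrite ler_norml; have := expR_ge1Dx (u x); have := expR_ge1Dx (- u x).
  have := expR_ge0 (u x); have := expR_ge0 (- u x); lra.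
have i1 : Q.-integrable [set: borelRd R d] (cst 1%E).
  exact: finite_measure_integrable_cst.
have I1 : (\int[Q]_x (cst 1) x = 1 :> \bar R)%E.
  by rewrite integral_cst// mul1e; exact: probability_setT.
have -> : (Idiv Q P = \int[Q]_x (u x)%:E)%E.
  rewrite /Idiv asboolT//; apply: ae_eq_integral => //.
  - by apply: measurableT_comp => //; exact: measurable_lne.
  - exact/measurable_EFinP.
  have : ae_eq Q [set: borelRd R d] ('d (charge_of_finite_measure Q) '/d P)
      (fun x => (expR (u x))%:E).
    apply: (null_dominates_ae_eq measurableT QP); apply: integral_ae_eq => //.
    - exact: Radon_Nikodym_integrable.
    - by apply/measurable_EFinP; exact: meu.
    - by move=> A _ mA; rewrite -Radon_Nikodym_integral//; exact: QPE.
  by apply: filterS => x /(_ I) -> _; rewrite lne_EFin ?expR_gt0// expRK.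
apply/andP; split.
  have <- : (\int[Q]_x ((cst 1 \- (fun x => (expR (- u x))%:E)) x) = 0)%E.
    by rewrite integralB// I1 IeNU subee.
  apply: le_integral => //; first exact: integrableB.
  move=> x _; rewrite -EFinB lee_fin; have := expR_ge1Dx (- u x); lra.
rewrite EFinB -IeU -I1 -integralB//.
apply: le_integral => //; first exact: integrableB.
by move=> x _; rewrite -EFinB lee_fin; have := expR_ge1Dx (u x); lra.
Qed.

(** The exponent is at most the larger of [a] and [b]. The bound is free of [t], hence usable for
    domination along a whole segment. *)
Lemma expR_convex_le (a b t : R) : 0 <= t <= 1 ->
  expR ((1 - t) * a + t * b) <= expR a + expR b.
Proof.
move=> /andP[t0 t1]; have [ab|/ltW ba] := leP a b.
  apply: (@le_trans _ _ (expR b)); last by rewrite lerDr expR_ge0.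
  by rewrite ler_expR; nra.
apply: (@le_trans _ _ (expR a)); last by rewrite lerDl expR_ge0.
by rewrite ler_expR; nra.
Qed.

Lemma dom_Lambda_segment theta tau (t : R) :
  dom_Lambda mu theta -> dom_Lambda mu tau -> 0 <= t <= 1 ->
  dom_Lambda mu ((1 - t) *: theta + t *: tau).
Proof.
move=> dtheta dtau t01.
have i1 := integrable_expR_dom mu mu_neq0 theta 0 dtheta.
have i2 := integrable_expR_dom mu mu_neq0 tau 0 dtau.
have i3 : mu.-integrable [set: borelRd R d]
    (fun x => (expR (dotp ((1 - t) *: theta + t *: tau) x - 0))%:E).
  apply: le_integrable (integrableD measurableT i1 i2) => //.
    by apply/measurable_EFinP; exact: measurable_expR_dotp.
  move=> x _; rewrite -EFinD /= lee_fin !subr0.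
  rewrite !ger0_norm ?addr_ge0 ?expR_ge0//.
  by rewrite dotpDl !dotpZl; exact: expR_convex_le.
have := integrable_lty measurableT i3; rewrite /dom_Lambda /Lambda/=.
under eq_integral do rewrite subr0.
by case: (integral _ _ _) => [r||]//= _; case: ifPn => // _; rewrite ltry.
Qed.

(** Dominated convergence with the sum of the exponentials at the two endpoints as bound, followed
    by the logarithm. *)
Lemma Lambda_segment_cvg theta tau (t : nat -> R) :
  dom_Lambda mu theta -> dom_Lambda mu tau -> (forall n, 0 <= t n <= 1) ->
  t @ \oo --> 0 ->
  fine (Lambda mu ((1 - t n) *: theta + t n *: tau)) @[n --> \oo] -->
  fine (Lambda mu theta).
Proof.
move=> dtheta dtau t01 tcvg.
have i1 := integrable_expR_dom mu mu_neq0 theta 0 dtheta.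
have i2 := integrable_expR_dom mu mu_neq0 tau 0 dtau.
pose f n (x : borelRd R d) :=
  (expR (dotp ((1 - t n) *: theta + t n *: tau) x))%:E.
have mf v : measurable_fun [set: borelRd R d] (fun x => (expR (dotp v x))%:E).
  apply/measurable_EFinP; have := measurable_expR_dotp v 0.
  by under eq_fun do rewrite subr0.
have [||_ _ If] := @dominated_convergence _ _ _ mu _ measurableT f
    (fun x => (expR (dotp theta x))%:E) _ (fun n => mf _) (mf theta) _
    (integrableD measurableT i1 i2).
- apply: aeW => x _; apply/fine_cvgP; split; first exact: nearW.
  rewrite /f /comp /=.
  have h : dotp ((1 - t n) *: theta + t n *: tau) x @[n --> \oo] -->
      dotp theta x.
    have : (1 - t n) * dotp theta x + t n * dotp tau x @[n --> \oo] -->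
        (1 - 0) * dotp theta x + 0 * dotp tau x.
      by apply: cvgD; apply: cvgMr_tmp => //; apply: cvgB => //; exact: cvg_cst.
    rewrite subr0 mul1r mul0r addr0.
    rewrite (_ : (fun n => (1 - t n) * _ + _) =
      (fun n => dotp ((1 - t n) *: theta + t n *: tau) x))//.
    by apply/funext => n; rewrite dotpDl !dotpZl.
  exact: (cvg_comp _ _ h (@continuous_expR R _)).
- apply: aeW => x n _; rewrite /f /= lee_fin !subr0 ger0_norm ?expR_ge0//.
  by rewrite dotpDl !dotpZl; exact: expR_convex_le.
have dt n := dom_Lambda_segment theta tau (t n) dtheta dtau (t01 n).
move: If; rewrite /f integral_expR_dom//.
under eq_fun do rewrite integral_expR_dom//.
move=> /fine_cvgP[_ /=] h.
rewrite -[fine (Lambda mu theta)]expRK.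
rewrite (_ : (fun n => _) = (fun n => ln (expR
    (fine (Lambda mu ((1 - t n) *: theta + t n *: tau)))))); last first.
  by apply/funext => n; rewrite expRK.
exact: (cvg_comp _ _ h (continuous_ln (expR_gt0 _))).
Qed.

Lemma expR_second_difference_cvg (a c : nat -> R) (l : R) :
  a @ \oo --> l -> c @ \oo --> l ->
  expR (a n + l - 2 * c n) - 1 @[n --> \oo] --> 0.
Proof.
move=> al cl.
have h : a n + l - 2 * c n @[n --> \oo] --> l + l - 2 * l.
  by apply: cvgB; [apply: cvgD => //; exact: cvg_cst|exact: cvgMl_tmp].
have : expR (a n + l - 2 * c n) - 1 @[n --> \oo] -->
    (expR (l + l - 2 * l) - 1 : R).
  apply: cvgB; last exact: cvg_cst.
  exact: (cvg_comp _ _ h (@continuous_expR R _)).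
by rewrite -mulr2n mulr_natl subrr expR0 subrr.
Qed.

Lemma expfam_closure_I_closure Xi : convex_set Xi -> Xi `<=` Theta mu ->
  expfam mu (closure Xi `&` Theta mu) `<=` I_closure (expfam mu Xi).
Proof.
move=> Xiconv XiT P [theta [clt [dtheta _]] PE].
have [tau tauXi] := convex_set_segment Xi theta Xiconv clt.
have dtau : dom_Lambda mu tau.
  have := tauXi 1; rewrite ltr01 lexx subrr scale0r add0r scale1r.
  by move=> /(_ isT)/XiT[].
pose s n : R := harmonic n.
have s0 n : 0 < s n by exact: harmonic_gt0.
have s1 n : s n <= 1 by rewrite /s/= invf_le1 ?ltr0n// ler1n.
pose v (t : R) := (1 - t) *: theta + t *: tau.
have vXi n : Xi (v (s n / 2)).
  by apply: tauXi; have := s0 n; have := s1 n; lra.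
(* The parameter is halved so that the third point of [Idiv_expfam_le],
   [2 *: v (s n / 2) - theta = v (s n)], still lies on the segment. *)
have vdom n : dom_Lambda mu (v (s n / 2)) by have [] := XiT _ (vXi n).
have /choice[Q QE] n := expfam_probability (v (s n / 2)) (vdom n).
exists Q.
  move=> n; exists (v (s n / 2)); first exact: vXi.
  exact: QE.
pose L t := fine (Lambda mu (v t)).
have vv n : 2 *: v (s n / 2) - theta = v (s n).
  by apply/rowP => i; rewrite /v !mxE; field.
have sdom n : dom_Lambda mu (v (s n)).
  by apply: dom_Lambda_segment => //; rewrite s1 ltW.
have scvg : s @ \oo --> 0 by exact: cvg_harmonic.
have s2cvg : s n / 2 @[n --> \oo] --> 0.
  have : s n / 2 @[n --> \oo] --> (0 / 2 : R) by exact: cvgMr_tmp.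
  by rewrite mul0r.
have Lcvg : L (s n) @[n --> \oo] --> fine (Lambda mu theta).
  by apply: Lambda_segment_cvg => // n; rewrite s1 ltW.
have L2cvg : L (s n / 2) @[n --> \oo] --> fine (Lambda mu theta).
  by apply: Lambda_segment_cvg => // n; have := s0 n; have := s1 n; lra.
pose b n := expR (L (s n) + fine (Lambda mu theta) - 2 * L (s n / 2)) - 1.
have bcvg : b @ \oo --> 0 := expR_second_difference_cvg _ _ _ Lcvg L2cvg.
have bound n : (0 <= Idiv (Q n) P <= (b n)%:E)%E.
  have := Idiv_expfam_le theta (v (s n / 2)) P (Q n) dtheta (vdom n).
  by rewrite vv => /(_ (sdom n) PE (QE n)).
apply: (@squeeze_cvge _ _ _ _ (cst 0%E) _ (EFin \o b)).
- exact: nearW.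
- exact: cvg_cst.
- by apply: cvg_EFin; [exact: nearW|].
Qed.

End exponential_family.

Theorem corollary2 (R : realType) (d : nat)
    (mu : {finite_measure set (borelRd R d) -> \bar R})
    (mu_neq0 : mu [set: borelRd R d] <> 0%E)
    (Xi : set 'rV[R]_d) (sub_Xi_Theta : Xi `<=` Theta mu) :
  [/\ variation_closure (expfam mu Xi) `&` expfam mu (Theta mu) `<=`
        expfam mu (closure Xi `&` Theta mu),
      I_closure (expfam mu Xi) `<=`
        variation_closure (expfam mu Xi) `&` expfam mu (Theta mu)
    & convex_set Xi ->
        expfam mu (closure Xi `&` Theta mu) =
          variation_closure (expfam mu Xi) `&` expfam mu (Theta mu) /\
        variation_closure (expfam mu Xi) `&` expfam mu (Theta mu) =
          I_closure (expfam mu Xi)].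
Proof.
have vI : variation_closure (expfam mu Xi) `&` expfam mu (Theta mu) `<=`
    expfam mu (closure Xi `&` Theta mu).
  move=> P [Pv [theta _ PE]]; apply: tv_limit_expfam => //.
  exact: expfam_dominates PE.
have Iv : I_closure (expfam mu Xi) `<=`
    variation_closure (expfam mu Xi) `&` expfam mu (Theta mu).
  move=> P PI.
  have [Pv [Q [tau _ QE] QP]] := I_closure_variation_closure _ _ PI.
  split => //.
  suff [theta [_ Ttheta] PE] : expfam mu (closure Xi `&` Theta mu) P.
    by exists theta.
  (* A [P]-null set is [Q]-null for a [Q] of the family, hence [mu]-null. *)
  apply: tv_limit_expfam => // A mA PA.
  apply: (expfam_dominates mu _ _ QE) => //.
  by move/null_content_dominatesP : QP; apply.
split => // Xiconv.
(* This inclusion closes the cycle of the three sets, so all of them coincide. *)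
have eI := expfam_closure_I_closure mu mu_neq0 Xi Xiconv sub_Xi_Theta.
split; apply/seteqP; split => //.
- exact: subset_trans eI Iv.
- exact: subset_trans vI eI.
Qed.
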